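(* Let $\zeta=e^{2\pi i/13}$, $\sqrt{13}>0$, and let $S$, $T\in GL(6,\mathbb{C})$ be $$S=-\frac{1}{\sqrt{13}}\begin{pmatrix} \zeta^{12}-\zeta & \zeta^{10}-\zeta^3 & \zeta^4-\zeta^9 & \zeta^5-\zeta^8 & \zeta^2-\zeta^{11} & \zeta^6-\zeta^7\\ \zeta^{10}-\zeta^3 & \zeta^4-\zeta^9 & \zeta^{12}-\zeta & \zeta^2-\zeta^{11} & \zeta^6-\zeta^7 & \zeta^5-\zeta^8\\ \zeta^4-\zeta^9 & \zeta^{12}-\zeta & \zeta^{10}-\zeta^3 & \zeta^6-\zeta^7 & \zeta^5-\zeta^8 & \zeta^2-\zeta^{11}\\ \zeta^5-\zeta^8 & \zeta^2-\zeta^{11} & \zeta^6-\zeta^7 & \zeta-\zeta^{12} & \zeta^3-\zeta^{10} & \zeta^9-\zeta^4\\ \zeta^2-\zeta^{11} & \zeta^6-\zeta^7 & \zeta^5-\zeta^8 & \zeta^3-\zeta^{10} & \zeta^9-\zeta^4 & \zeta-\zeta^{12}\\ \zeta^6-\zeta^7 & \zeta^5-\zeta^8 & \zeta^2-\zeta^{11} & \zeta^9-\zeta^4 & \zeta-\zeta^{12} & \zeta^3-\zeta^{10} \end{pmatrix},\qquad T=\mathrm{diag}(\zeta^7,\zeta^{11},\zeta^8,\zeta^6,\zeta^2,\zeta^5).$$ Let $G$ be the subgroup of $PGL(6,\mathbb{C})$ generated by the images of $S$ and $T$. Put $P=ST^{-1}S$, $Q=ST^3$, and $$x_1=Q^6\cdot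 PQ^2P^{10},\quad y_1=PQ^2P^{10},\quad x_2=Q^5\cdot Q^5P^2\cdot P^2Q^6P^8\cdot Q^5P^2,\quad y_2=Q^5P^2\cdot P^2Q^6P^8\cdot Q^5P^2.$$ Then $G$ is generated by the images of $x_1,y_1$, and also by the images of $x_2,y_2$.
   Context: Matrices in $GL(6,\mathbb{C})$ are regarded as projective transformations of $\mathbb{P}^5$, i.e. via their images in $PGL(6,\mathbb{C})$. *)

(* Defs.v *)
From HB Require Import structures.
From mathcomp Require Import all_boot all_order all_algebra.
From mathcomp Require Import ring lra.
From mathcomp Require Import all_classical all_reals all_analysis.
From mathcomp Require Import complex.

Set Implicit Arguments.
Unset Strict Implicit.
Unset Printing Implicit Defensive.

Import Order.TTheory GRing.Theory Num.Theory.

Local Open Scope quotient_scope.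
Local Open Scope ring_scope.

Section GeneralLinearGroup.
Variables (F : fieldType) (n : nat).

Record GL := MkGL { glmx :> 'M[F]_n; glmx_unit : glmx \in unitmx }.

HB.instance Definition _ := [isSub for glmx].
HB.instance Definition _ := [Choice of GL by <:].

Implicit Types A B C : GL.

Lemma GL_mul_subproof A B : A *m B \in unitmx.
Proof. by rewrite unitmx_mul !glmx_unit. Qed.
Lemma GL_inv_subproof A : invmx A \in unitmx.
Proof. by rewrite unitmx_inv glmx_unit. Qed.

Definition GL_one := MkGL (unitmx1 F n).
Definition GL_mul A B := MkGL (GL_mul_subproof A B).
Definition GL_inv A := MkGL (GL_inv_subproof A).

Lemma GL_mulA : associative GL_mul.
Proof. by move=> A B C; apply/val_inj/mulmxA. Qed.
Lemma GL_mul1 : left_id GL_one GL_mul.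
Proof. by move=> A; apply/val_inj/mul1mx. Qed.
Lemma GL_mulr1 : right_id GL_one GL_mul.
Proof. by move=> A; apply/val_inj/mulmx1. Qed.
Lemma GL_mulV : left_inverse GL_one GL_inv GL_mul.
Proof. by move=> A; apply/val_inj/mulVmx/glmx_unit. Qed.
Lemma GL_mulrV : right_inverse GL_one GL_inv GL_mul.
Proof. by move=> A; apply/val_inj/mulmxV/glmx_unit. Qed.

HB.instance Definition _ :=
  isGroup.Build GL GL_mulA GL_mul1 GL_mulr1 GL_mulV GL_mulrV.

Lemma GL_mulE A B : (A * B)%g = A *m B :> 'M[F]_n. Proof. by []. Qed.
Lemma GL_invE A : ((A^-1)%g : 'M[F]_n) = invmx A. Proof. by []. Qed.

(* PGL is the quotient of GL by the scalar matrices: A and B have the same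
   class when A^-1 * B is scalar. *)
Definition proj_eq : rel GL := fun A B => is_scalar_mx (A^-1 * B)%g.

Lemma proj_eqP A B :
  reflect (exists a : F, B = a *: glmx A :> 'M[F]_n) (proj_eq A B).
Proof.
apply: (iffP is_scalar_mxP) => -[a eqAB]; exists a.
  rewrite -[LHS](mulKVmx (glmx_unit A)) -mul_mx_scalar.
  by congr (_ *m _).
by rewrite GL_mulE GL_invE eqAB -scalemxAr mulVmx ?glmx_unit // scalemx1.
Qed.

Lemma proj_eq_refl : reflexive proj_eq.
Proof. by move=> A; apply/proj_eqP; exists 1; rewrite scale1r. Qed.

Lemma proj_eq_sym : symmetric proj_eq.
Proof.
suff H A B : proj_eq A B -> proj_eq B A by move=> A B; apply/idP/idP; apply: H.
move=> /proj_eqP [a eB]; apply/proj_eqP.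
have [a0|a0] := eqVneq a 0; last first.
  by exists a^-1; rewrite eB scalerA mulVf // scale1r.
exists 1; rewrite scale1r.
have B0 : glmx B = 0 by rewrite eB a0 scale0r.
have I0 : (1%:M : 'M[F]_n) = 0 by rewrite -(mulVmx (glmx_unit B)) B0 mulmx0.
by rewrite B0 -[LHS]mul1mx I0 mul0mx.
Qed.

Lemma proj_eq_trans : transitive proj_eq.
Proof.
move=> B A C /proj_eqP [a eB] /proj_eqP [b eC]; apply/proj_eqP.
by exists (b * a); rewrite eC eB scalerA.
Qed.

Canonical proj_equiv := EquivRel proj_eq proj_eq_refl proj_eq_sym proj_eq_trans.

Definition PGL := ({eq_quot proj_eq})%qT.
HB.instance Definition _ := EqQuotient.on PGL.
HB.instance Definition _ := Choice.on PGL.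

Definition to_PGL (A : GL) : PGL := \pi_(PGL)%qT A.

Lemma projP A B : to_PGL A = to_PGL B <-> exists a : F, B = a *: glmx A :> 'M[F]_n.
Proof.
rewrite /to_PGL; split => [/eqquotP|] /proj_eqP // H; exact/eqquotP.
Qed.

Lemma reprK_proj (x : PGL) : to_PGL (repr x) = x.
Proof. exact: reprK. Qed.

Definition PGL_one := to_PGL 1%g.
Definition PGL_mul (x y : PGL) := to_PGL (repr x * repr y)%g.
Definition PGL_inv (x : PGL) := to_PGL (repr x)^-1%g.

Lemma PGL_mulE A B : PGL_mul (to_PGL A) (to_PGL B) = to_PGL (A * B)%g.
Proof.
have /projP [a ea] := reprK_proj (to_PGL A).
have /projP [b eb] := reprK_proj (to_PGL B).
apply/projP; exists (a * b).
by rewrite !GL_mulE ea eb -scalemxAl -scalemxAr scalerA.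
Qed.

Lemma PGL_invE A : PGL_inv (to_PGL A) = to_PGL A^-1%g.
Proof.
have /esym/projP [a ea] := reprK_proj (to_PGL A).
apply/projP; exists a; rewrite !GL_invE.
apply: (can_inj (mulKmx (glmx_unit A))).
rewrite mulmxV ?glmx_unit // -scalemxAr scalemxAl -ea.
by rewrite mulmxV ?glmx_unit.
Qed.

Lemma PGL_ind (K : PGL -> Prop) : (forall A, K (to_PGL A)) -> forall x, K x.
Proof. by move=> KP x; rewrite -(reprK_proj x). Qed.

Lemma PGL_mulA : associative PGL_mul.
Proof.
elim/PGL_ind=> A; elim/PGL_ind=> B; elim/PGL_ind=> C.
by rewrite !PGL_mulE mulgA.
Qed.
Lemma PGL_mul1 : left_id PGL_one PGL_mul.
Proof. by elim/PGL_ind=> A; rewrite PGL_mulE mul1g. Qed.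
Lemma PGL_mulr1 : right_id PGL_one PGL_mul.
Proof. by elim/PGL_ind=> A; rewrite PGL_mulE mulg1. Qed.
Lemma PGL_mulV : left_inverse PGL_one PGL_inv PGL_mul.
Proof. by elim/PGL_ind=> A; rewrite PGL_invE PGL_mulE mulVg. Qed.
Lemma PGL_mulrV : right_inverse PGL_one PGL_inv PGL_mul.
Proof. by elim/PGL_ind=> A; rewrite PGL_invE PGL_mulE mulgV. Qed.

HB.instance Definition _ :=
  isGroup.Build PGL PGL_mulA PGL_mul1 PGL_mulr1 PGL_mulV PGL_mulrV.

Lemma projM A B : to_PGL (A * B)%g = (to_PGL A * to_PGL B)%g.
Proof. by rewrite -PGL_mulE. Qed.
Lemma projV A : to_PGL A^-1%g = (to_PGL A)^-1%g.
Proof. by rewrite -PGL_invE. Qed.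

End GeneralLinearGroup.

Section GeneratedSubgroup.
Variable gT : groupType.

Definition is_subgroup (H : set gT) : Prop :=
  [/\ H 1%g,
      forall x y, H x -> H y -> H (x * y)%g
    & forall x, H x -> H x^-1%g].

(* the intersection of all subgroups containing A *)
Definition subgroup_generated (A : set gT) : set gT := smallest is_subgroup A.

End GeneratedSubgroup.

Section Generators.
Variable R : realType.
Local Open Scope complex_scope.

(* e^(it) by Euler's formula *)
Definition expi (t : R) : R[i] := cos t +i* sin t.

Lemma expiD s t : expi (s + t) = expi s * expi t.
Proof.
rewrite /expi cosD sinD; apply/eqP; rewrite eq_complex /= eqxx /=.
by rewrite addrC.
Qed.

Lemma expiMn t k : expi t ^+ k = expi (t *+ k).
Proof.
elim: k => [|k IH]; first by rewrite expr0 mulr0n /expi cos0 sin0.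
by rewrite exprS mulrS expiD IH.
Qed.

Definition zeta : R[i] := expi (2 * pi / 13).

Lemma zeta13 : zeta ^+ 13 = 1.
Proof.
have -> : zeta ^+ 13 = expi (pi *+ 2).
  rewrite expiMn; congr expi.
  by rewrite -[LHS]mulr_natr -[RHS]mulr_natl divfK // pnatr_eq0.
by rewrite /expi cos2pi sin2pi.
Qed.

Lemma zeta_neq1 : zeta != 1.
Proof.
rewrite eq_complex /= negb_and; apply/orP; right.
rewrite gt_eqF // sin_gt0_pi //.
by have := pi_gt0 R; lra.
Qed.

Lemma zeta_neq0 : zeta != 0.
Proof.
apply/eqP => z0; have := zeta13; rewrite z0 expr0n /= => /esym/eqP.
by rewrite oner_eq0.
Qed.

Lemma zeta12 : zeta ^+ 12 = - (1 + zeta + zeta ^+ 2 + zeta ^+ 3 + zeta ^+ 4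
  + zeta ^+ 5 + zeta ^+ 6 + zeta ^+ 7 + zeta ^+ 8 + zeta ^+ 9 + zeta ^+ 10
  + zeta ^+ 11).
Proof.
apply: (@mulfI _ (zeta - 1)); first by rewrite subr_eq0 zeta_neq1.
apply/eqP; rewrite -subr_eq0; apply/eqP.
suff -> : forall z w : R[i], (z - 1) * w - (z - 1) * - (1 + z + z ^+ 2 + z ^+ 3
   + z ^+ 4 + z ^+ 5 + z ^+ 6 + z ^+ 7 + z ^+ 8 + z ^+ 9 + z ^+ 10 + z ^+ 11)
   = (z - 1) * (w - z ^+ 12) + (z ^+ 13 - 1).
  by rewrite subrr mulr0 add0r zeta13 subrr.
by move=> z w; ring.
Qed.

Definition S_entries : seq (seq R[i]) :=
  let z := zeta in
  [:: [:: z^+12 - z;    z^+10 - z^+3; z^+4 - z^+9;  z^+5 - z^+8;  z^+2 - z^+11; z^+6 - z^+7];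
      [:: z^+10 - z^+3; z^+4 - z^+9;  z^+12 - z;    z^+2 - z^+11; z^+6 - z^+7;  z^+5 - z^+8];
      [:: z^+4 - z^+9;  z^+12 - z;    z^+10 - z^+3; z^+6 - z^+7;  z^+5 - z^+8;  z^+2 - z^+11];
      [:: z^+5 - z^+8;  z^+2 - z^+11; z^+6 - z^+7;  z - z^+12;    z^+3 - z^+10; z^+9 - z^+4];
      [:: z^+2 - z^+11; z^+6 - z^+7;  z^+5 - z^+8;  z^+3 - z^+10; z^+9 - z^+4;  z - z^+12];
      [:: z^+6 - z^+7;  z^+5 - z^+8;  z^+2 - z^+11; z^+9 - z^+4;  z - z^+12;    z^+3 - z^+10]].

Definition S_mx : 'M[R[i]]_6 :=
  - ((Num.sqrt 13)%:C)^-1 *: \matrix_(i < 6, j < 6) (nth [::] S_entries i)`_j.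

Definition T_mx : 'M[R[i]]_6 :=
  let z := zeta in
  diag_mx (\row_(j < 6) [:: z^+7; z^+11; z^+8; z^+6; z^+2; z^+5]`_j).

Lemma sqrt13_neq0 : (Num.sqrt 13)%:C != 0 :> R[i].
Proof.
rewrite (_ : 0 = 0%:C) // (inj_eq (@complexI R)).
by rewrite gt_eqF // sqrtr_gt0 ltr0n.
Qed.

Lemma S_entries_sqr :
  let M := \matrix_(i < 6, j < 6) (nth [::] S_entries i)`_j in
  M *m M = (- 13)%:M.
Proof.
rewrite /=; apply/matrixP => i j; rewrite !mxE.
under eq_bigr do rewrite !mxE.
rewrite !big_ord_recl big_ord0 /=.
have z12 := zeta12; rewrite /S_entries; move: z12; move: zeta => z z12.
case: i => [[|[|[|[|[|[|i]]]]]] // Hi];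
  case: j => [[|[|[|[|[|[|j]]]]]] // Hj];
  rewrite -[_ == _]/(nat_of_ord _ == nat_of_ord _) /= ?mulr1n ?mulr0n.
all: by ring: z12.
Qed.

Lemma S_mx_unit : S_mx \in unitmx.
Proof.
rewrite /S_mx unitmxZ; last by rewrite unitfE oppr_eq0 invr_eq0 sqrt13_neq0.
set M := \matrix_(i, j) _.
suff /mulmx1_unit[] : M *m ((- 13)^-1 *: M) = 1%:M by [].
by rewrite -scalemxAr S_entries_sqr scale_scalar_mx mulVf // oppr_eq0 pnatr_eq0.
Qed.

Lemma T_mx_unit : T_mx \in unitmx.
Proof.
rewrite unitmxE det_diag unitfE prodf_seq_neq0; apply/allP => i _ /=.
rewrite mxE; case: i => [[|[|[|[|[|[|i]]]]]] // Hi] /=;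
  by rewrite expf_neq0 ?zeta_neq0.
Qed.

Definition S_GL : GL R[i] 6 := MkGL S_mx_unit.
Definition T_GL : GL R[i] 6 := MkGL T_mx_unit.

End Generators.

(* Main.v *)
Require Import Defs.
From mathcomp Require Import all_boot all_order all_algebra.
From mathcomp Require Import ring.
From mathcomp Require Import all_classical all_reals all_analysis.
From mathcomp Require Import complex.

Set Implicit Arguments.
Unset Strict Implicit.
Unset Printing Implicit Defensive.

Import GRing.Theory.

(** The images s, t of S, T in PGL(6, C), together with the image h of a signed
    permutation matrix H, satisfy the relations of PSL(2, 13) for
    s = [[0,-1],[1,0]], t = [[1,1],[0,1]] and h = diag(2, 1/2).  These relations
    suffice to bring every word in s and t to a Bruhat normal form t^i h^j or
    t^i s h^j t^k, hence to decide equalities between words by computation.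
    Each pair x_i, y_i is a word in s and t, and conversely s and t are equal
    to explicit words in x_i and y_i. *)

(** * Words in two generators and the subgroups they generate *)

Section Words.
Variable gT : groupType.
Local Open Scope group_scope.
Local Open Scope classical_set_scope.
Implicit Types (x y : gT) (u v w : seq bool).

(* The letter [true] stands for the first generator, [false] for the second. *)
Definition word_val x y w : gT :=
  foldr (fun b g => (if b then x else y) * g) 1 w.

Definition word_subst u v w : seq bool :=
  flatten [seq if b then u else v | b <- w].

Definition word_pow w n : seq bool := flatten (nseq n w).

Lemma word_val_cat x y u v :
  word_val x y (u ++ v) = word_val x y u * word_val x y v.
Proof. by elim: u => [|b u IHu] /=; rewrite ?mul1g // IHu mulgA. Qed.

Lemma word_val_pow x y w n : word_val x y (word_pow w n) = word_val x y w ^+ n.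
Proof.
elim: n => [|n IHn]; first by rewrite expg0.
by rewrite /word_pow /= word_val_cat -/(word_pow w n) IHn expgS.
Qed.

Lemma word_val_subst x y u v w :
  word_val x y (word_subst u v w) = word_val (word_val x y u) (word_val x y v) w.
Proof.
elim: w => [|b w IHw] //=.
by rewrite /word_subst /= word_val_cat -/(word_subst u v w) IHw; case: b.
Qed.

Lemma word_val_subgroup (H : set gT) x y w :
  is_subgroup H -> H x -> H y -> H (word_val x y w).
Proof.
by case=> H1 HM _ Hx Hy; elim: w => [|b w IHw] //=; apply: HM => //; case: b.
Qed.

(** Every subgroup containing one pair contains the other: [u] and [v] lead from [x], [y] to the new
    generators, and [u'] and [v'] lead back. *)
Lemma subgroup_generated_words x y u v (u' v' : seq bool) :
    word_val x y (word_subst u v u') = x ->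
    word_val x y (word_subst u v v') = y ->
  subgroup_generated [set x; y] =
  subgroup_generated [set word_val x y u; word_val x y v].
Proof.
rewrite !word_val_subst => xE yE; apply/seteqP; split => g Hg H [sgH sub].
  have [Hu Hv] : H (word_val x y u) /\ H (word_val x y v).
    by split; apply: sub; [left | right].
  apply: Hg; split=> // _ [->|->]; [rewrite -xE | rewrite -yE];
    exact: word_val_subgroup.
have [Hx Hy] : H x /\ H y by split; apply: sub; [left | right].
by apply: Hg; split=> // _ [->|->]; apply: word_val_subgroup.
Qed.

End Words.

(** * Bruhat normal forms from the relations of PSL(2, 13) *)

Lemma expg_mod_order1 (gT : groupType) (x : gT) n i :
  (x ^+ n = 1 -> x ^+ (i %% n)%N = x ^+ i)%g.
Proof.
by move=> xn; rewrite [in RHS](divn_eq i n) expgnDr mulnC expgnA xn expg1n mul1g.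
Qed.

Section BruhatNormalForm.
Variable gT : groupType.
Local Open Scope group_scope.

Definition psl2_13_relations (s t h : gT) : Prop :=
  [/\ [/\ s ^+ 2 = 1, t ^+ 13 = 1 & h ^+ 6 = 1],
      [/\ h * t = t ^+ 4 * h & h * s * h = s] &
      [/\ s * t * s = t ^+ 12 * s * t ^+ 12 &
          s * t ^+ 2 * s = t ^+ 6 * s * h * t ^+ 6]].

(* [Borel i j] stands for t^i h^j and [BigCell i j k] for t^i s h^j t^k. *)
Inductive bruhat := Borel of nat & nat | BigCell of nat & nat & nat.

(* [shift m j i] is m^j * i modulo 13, computed without large unary numbers. *)
Definition shift (m j i : nat) : nat := iter j (fun k => m * k %% 13)%N i.

(** Discrete logarithm to base 2, a primitive root modulo 13; meaningful for 0 < i < 13 only, since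
    [index] returns 12 on a missing value. *)
Definition dlog2 (i : nat) : nat :=
  index i [seq shift 2 k 1 | k <- iota 0 12].

Definition mul_t (g : bruhat) : bruhat :=
  match g with
  | Borel i j => Borel (i.+1 %% 13)%N j
  | BigCell i j k => BigCell (i.+1 %% 13)%N j k
  end.

(** Powers of [t] cross h^j by factors 4^j or 10^j, where 10 = 1/4 modulo 13. In the second case the
    two [s] cancel; in the last, s t^i s = t^e s h^d t^e with e = -1/i. *)
Definition mul_s (g : bruhat) : bruhat :=
  match g with
  | Borel i j => BigCell 0 j (shift 10 j i)
  | BigCell 0 j k => Borel (shift 4 j k) j
  | BigCell i j k =>
    let d := dlog2 i in let e := shift 2 (18 - d)%N 1 in
    BigCell e ((d + j) %% 6)%N ((shift 10 j e + k) %% 13)%N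
  end.

Definition bruhat_of_word (w : seq bool) : bruhat :=
  foldr (fun b : bool => if b then mul_s else mul_t) (Borel 0 0) w.

(** Only the left exponent of a big cell is passed to [dlog2], so only it is bounded. *)
Definition bruhat_bounded (g : bruhat) : bool :=
  if g is BigCell i _ _ then (i < 13)%N else true.

Variables s t h : gT.
Hypothesis rels : psl2_13_relations s t h.

Definition bruhat_val (g : bruhat) : gT :=
  match g with
  | Borel i j => t ^+ i * h ^+ j
  | BigCell i j k => t ^+ i * s * h ^+ j * t ^+ k
  end.

Lemma t_mod i : t ^+ (i %% 13)%N = t ^+ i.
Proof. by case: rels => -[_ t13 _] _ _; apply: expg_mod_order1. Qed.

Lemma eq_tX i j : i = j %[mod 13] -> t ^+ i = t ^+ j.
Proof. by rewrite -(t_mod i) -(t_mod j) => ->. Qed.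

Lemma h_mod i : h ^+ (i %% 6)%N = h ^+ i.
Proof. by case: rels => -[_ _ h6] _ _; apply: expg_mod_order1. Qed.

Lemma ht i : h * t ^+ i = t ^+ (4 * i)%N * h.
Proof.
case: rels => _ [ht _] _; elim: i => [|i IHi]; first by rewrite !expg0 mulg1 mul1g.
by rewrite expgS mulgA ht -mulgA IHi mulgA -expgnDr mulnS.
Qed.

Lemma th i : t ^+ i * h = h * t ^+ (10 * i)%N.
Proof.
rewrite ht mulnA; congr (_ * h); apply: eq_tX.
by rewrite -[in RHS]modnMml mul1n.
Qed.

Lemma hXt j i : h ^+ j * t ^+ i = t ^+ shift 4 j i * h ^+ j.
Proof.
elim: j => [|j IHj]; first by rewrite !expg0 mulg1 mul1g.
by rewrite expgS -mulgA IHj mulgA ht -mulgA /= t_mod.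
Qed.

Lemma thX j i : t ^+ i * h ^+ j = h ^+ j * t ^+ shift 10 j i.
Proof.
elim: j => [|j IHj]; first by rewrite !expg0 mulg1 mul1g.
by rewrite expgSr mulgA IHj -mulgA th mulgA /= t_mod.
Qed.

(** Conjugate by [h]: t^i becomes t^(4i), and since s h = h^-1 s, moving h^-1 across [s] supplies
    one new factor [h] and the trailing conjugator another. *)
Lemma s_tX4_s k i e :
    s * t ^+ i * s = t ^+ e * s * h ^+ k * t ^+ e ->
  s * t ^+ (4 * i)%N * s = t ^+ (10 * e)%N * s * h ^+ k.+2 * t ^+ (10 * e)%N.
Proof.
case: rels => _ [_ hsh] _ sts.
have sh : s * h = h^-1 * s by rewrite -[in RHS]hsh -!mulgA mulKg.
have -> : t ^+ (4 * i)%N = h * t ^+ i * h^-1 by rewrite ht mulgK.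
have -> : s * (h * t ^+ i * h^-1) * s = h^-1 * (s * t ^+ i * s) * h.
  rewrite !mulgA sh -!mulgA; congr (_ * (_ * (_ * _))).
  by rewrite -[s in LHS]hsh !mulgA mulVg mul1g.
rewrite sts (expgS h k.+1) (expgSr h k) !mulgA -(mulgA _ (t ^+ e) h) th !mulgA.
have -> : h^-1 * t ^+ e = t ^+ (10 * e)%N * h^-1.
  by apply: (mulgI h); rewrite mulVKg mulgA -th mulgK.
by rewrite -(mulgA _ h^-1 s) -sh !mulgA.
Qed.

(* For a = 2^k this is s t^a s = t^(-1/a) s h^k t^(-1/a), where
   -1/a = 2^(18 - k) because 2^6 = -1 modulo 13. *)
Lemma s_tX_s k : (k <= 18)%N ->
  s * t ^+ shift 2 k 1 * s =
  t ^+ shift 2 (18 - k)%N 1 * s * h ^+ k * t ^+ shift 2 (18 - k)%N 1.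
Proof.
case: rels => _ _ [sts st2s].
(* Passing from 2^k to 2^(k+2) is one use of [s_tX4_s], so the two relations for s t s and s t^2 s
   serve as base cases, with 2^18 = 12 and 2^17 = 6 modulo 13. *)
elim/ltn_ind: k => -[|[|k]] IHk le_k.
- by rewrite expg0 mulg1; apply: sts.
- exact: st2s.
have shift2 n : t ^+ shift 2 n.+2 1 = t ^+ (4 * shift 2 n 1)%N.
  by apply: eq_tX; rewrite /= modn_mod modnMmr mulnA.
rewrite shift2 (s_tX4_s (IHk k _ _)) ?(ltnW (ltnW le_k)) //.
congr (_ * _ * _ * _); apply: eq_tX;
  by rewrite -(subnSK (ltnW le_k)) -(subnSK le_k) /= !(modnMmr, mulnA) -modnMml mul1n.
Qed.

Lemma s_tX_s_dlog i : (0 < i < 13)%N ->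
  let e := shift 2 (18 - dlog2 i)%N 1 in
  s * t ^+ i * s = t ^+ e * s * h ^+ dlog2 i * t ^+ e.
Proof.
move=> i_bd e; have [iE le_i] : shift 2 (dlog2 i) 1 = i /\ (dlog2 i <= 18)%N.
  by move: i i_bd {e}; do 13?[case=> //].
by rewrite -[X in s * t ^+ X]iE s_tX_s.
Qed.

Lemma mul_tE g : bruhat_val (mul_t g) = t * bruhat_val g.
Proof. by case: g => [i j|i j k] /=; rewrite t_mod expgS !mulgA. Qed.

Lemma mul_sE g : bruhat_bounded g -> bruhat_val (mul_s g) = s * bruhat_val g.
Proof.
case: g => [i j|[|i] j k] bd_g.
- by rewrite /= thX expg0 mul1g mulgA.
- case: rels => -[s2 _ _] _ _.
  by rewrite /= -hXt expg0 mul1g !mulgA -[s * s]/(s ^+ 2) s2 mul1g.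
have := s_tX_s_dlog (bd_g : 0 < i.+1 < 13)%N; rewrite /mul_s.
move: (dlog2 _) => d; set e := shift _ _ _ => sts.
rewrite /bruhat_val t_mod h_mod !mulgA sts -(mulgA _ (t ^+ e) (h ^+ j)) thX.
by rewrite expgnDr expgnDr !mulgA.
Qed.

Lemma bruhat_of_word_bounded w : bruhat_bounded (bruhat_of_word w).
Proof.
have shift_lt m j : (shift m j 1 < 13)%N by case: j => //= j; rewrite ltn_pmod.
elim: w => //= -[] w; last by case: bruhat_of_word => *; rewrite /= ?ltn_pmod.
by case: bruhat_of_word => [i j|[|i] j k] // _; apply: shift_lt.
Qed.

Lemma bruhat_of_wordE w : bruhat_val (bruhat_of_word w) = word_val s t w.
Proof.
elim: w => [|b w IHw]; first by rewrite /= !expg0 mulg1.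
by case: b; rewrite /= ?mul_tE ?mul_sE ?bruhat_of_word_bounded // IHw.
Qed.

Lemma eq_word_val w w' : bruhat_of_word w = bruhat_of_word w' ->
  word_val s t w = word_val s t w'.
Proof. by rewrite -!bruhat_of_wordE => ->. Qed.

End BruhatNormalForm.

(** * The relations for the matrices modulo scalars *)

Lemma to_PGLX (F : fieldType) n (A : GL F n) k :
  (to_PGL (A ^+ k) = to_PGL A ^+ k)%g.
Proof. by elim: k => // k IHk; rewrite !expgS projM IHk. Qed.

Section MatrixRelations.
Local Open Scope ring_scope.
Variable R : realType.
Local Notation z := (zeta R).

(* [S_mx] without its scalar factor, which is irrelevant in PGL. *)
Definition M_mx : 'M[R[i]]_6 :=
  \matrix_(i < 6, j < 6) (nth [::] (S_entries R) i)`_j.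

Definition H_entries : seq (seq R[i]) :=
  [:: [:: 0; 0; 0; 0; -1; 0];
      [:: 0; 0; 0; 0; 0; -1];
      [:: 0; 0; 0; -1; 0; 0];
      [:: 0; 1; 0; 0; 0; 0];
      [:: 0; 0; 1; 0; 0; 0];
      [:: 1; 0; 0; 0; 0; 0]].

Definition H_mx : 'M[R[i]]_6 :=
  \matrix_(i < 6, j < 6) (nth [::] H_entries i)`_j.

(* The quadratic Gauss sum, equal to the square root of 13. *)
Definition gauss_sum : R[i] :=
  z + z ^+ 3 + z ^+ 4 + z ^+ 9 + z ^+ 10 + z ^+ 12
  - (z ^+ 2 + z ^+ 5 + z ^+ 6 + z ^+ 7 + z ^+ 8 + z ^+ 11).

Definition zdiag (l : seq nat) : 'M[R[i]]_6 :=
  diag_mx (\row_(j < 6) z ^+ nth 0%N l j).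

Lemma zeta_exp_mod n : z ^+ (n %% 13) = z ^+ n.
Proof. by apply: expr_mod; rewrite zeta13. Qed.

(** Reducing the exponents makes each power of [T_GL] match, by computation, a literal list in the
    matrix identities below. *)
Lemma T_GL_expE k :
  glmx (T_GL R ^+ k)%g = zdiag [seq e * k %% 13 | e <- [:: 7; 11; 8; 6; 2; 5]]%N.
Proof.
elim: k => [|k IHk].
  transitivity (1%:M : 'M[R[i]]_6); first by rewrite expg0.
  rewrite -diag_const_mx /zdiag; congr diag_mx; apply/rowP => j; rewrite !mxE.
  by case: j => [[|[|[|[|[|[|j]]]]]] Hj].
rewrite expgS GL_mulE IHk /zdiag /= mulmx_diag; congr diag_mx.
apply/rowP => j; rewrite !mxE.
by case: j => [[|[|[|[|[|[|j]]]]]] Hj] //=;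
  rewrite !zeta_exp_mod -exprD mulnS.
Qed.

Ltac mx6_cases :=
  case=> [[|[|[|[|[|[|?]]]]]] // ?]; case=> [[|[|[|[|[|[|?]]]]]] // ?].

(** With [gauss_sum] in place of the root of 13, each entry is a polynomial identity in zeta modulo
    the cyclotomic relation [zeta12], which [ring] decides. The lists belong to T and T^12. *)
Lemma M_T_M :
  let T1 := zdiag [:: 7; 11; 8; 6; 2; 5] in
  let T12 := zdiag [:: 6; 2; 5; 7; 11; 8] in
  M_mx *m T1 *m M_mx = - gauss_sum *: (T12 *m M_mx *m T12).
Proof.
rewrite /zdiag /= mul_mx_diag mul_diag_mx mul_mx_diag.
apply/matrixP => i j; rewrite !mxE !big_ord_recl !big_ord0 !mxE /= /gauss_sum /S_entries.
move: i j; have := zeta12 R; move: z => w z12.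
by mx6_cases; rewrite /=; ring: z12.
Qed.

Lemma M_T2_M :
  let T2 := zdiag [:: 1; 9; 3; 12; 4; 10] in
  let T6 := zdiag [:: 3; 1; 9; 10; 12; 4] in
  M_mx *m T2 *m M_mx = gauss_sum *: (T6 *m M_mx *m H_mx *m T6).
Proof.
rewrite /zdiag /= !mul_mx_diag mul_diag_mx.
apply/matrixP => i j; rewrite !mxE !big_ord_recl !big_ord0 !mxE /= /gauss_sum /S_entries.
move: i j; have := zeta12 R; move: z => w z12.
by mx6_cases; rewrite /=; ring: z12.
Qed.

Lemma H_T :
  H_mx *m zdiag [:: 7; 11; 8; 6; 2; 5] = zdiag [:: 2; 5; 6; 11; 8; 7] *m H_mx.
Proof.
rewrite /zdiag mul_mx_diag mul_diag_mx.
apply/matrixP => i j; rewrite !mxE.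
by move: i j; mx6_cases; rewrite /= ?mulr0 ?mul0r // mulrC.
Qed.

Lemma H_trmx : H_mx *m H_mx^T = 1%:M.
Proof.
apply/matrixP => i j; rewrite !mxE !big_ord_recl !big_ord0 !mxE /=.
by move: i j; mx6_cases; rewrite -[_ == _]/(nat_of_ord _ == nat_of_ord _) /=; ring.
Qed.

(** Since the transpose of [H_mx] is its inverse, this amounts to H^6 = -1, so [h] has sixth power 1
    only projectively. *)
Lemma H_cube : H_mx *m H_mx *m H_mx = - (H_mx^T *m H_mx^T *m H_mx^T).
Proof.
apply/matrixP => i j; rewrite !mxE !big_ord_recl !big_ord0 !mxE.
rewrite !big_ord_recl !big_ord0 !mxE /=.
by move: i j; mx6_cases; rewrite /=; ring.
Qed.

Lemma H_M : H_mx *m M_mx = M_mx *m H_mx^T.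
Proof.
apply/matrixP => i j; rewrite !mxE !big_ord_recl !big_ord0 !mxE /= /S_entries.
move: i j; move: z => w.
by mx6_cases; rewrite /=; ring.
Qed.

Lemma H_mx_unit : H_mx \in unitmx.
Proof. by have /mulmx1_unit[] := H_trmx. Qed.

Definition H_GL : GL R[i] 6 := MkGL H_mx_unit.

Lemma S_GL_E : glmx (S_GL R) = - ((Num.sqrt 13)%:C)%C^-1 *: M_mx.
Proof. by []. Qed.

Lemma PGL_relations :
  psl2_13_relations (to_PGL (S_GL R)) (to_PGL (T_GL R)) (to_PGL H_GL).
Proof.
set r := - ((Num.sqrt 13)%:C)%C^-1 : R[i].
have T1 : glmx (T_GL R) = zdiag [:: 7; 11; 8; 6; 2; 5]%N := T_GL_expE 1.
have HTH : H_mx^T *m H_mx = 1%:M := mulmx1C H_trmx.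
have HTK (A : 'M[R[i]]_6) : H_mx^T *m (H_mx *m A) = A.
  by rewrite mulmxA HTH mul1mx.
have rel (A B : GL R[i] 6) a : glmx A = a *: glmx B -> to_PGL A = to_PGL B.
  by move=> AE; apply/esym/projP; exists a.
split; split.
- rewrite -to_PGLX; apply: (rel _ 1%g (r ^+ 2 * - 13)).
  rewrite expgS expg1 GL_mulE S_GL_E -scalemxAl -scalemxAr scalerA -expr2.
  by rewrite S_entries_sqr -[in LHS]scalemx1 scalerA.
- rewrite -to_PGLX; apply: (rel _ 1%g 1).
  by rewrite scale1r T_GL_expE -(T_GL_expE 0).
- rewrite -to_PGLX; apply: (rel _ 1%g (-1)).
  (* Split H^6 as H^3 H^3; [H_cube] turns the first factor into minus the inverse of the second. *)
  rewrite (expgnDr _ 3 3) !expgS expg0 mulg1 !GL_mulE /=.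
  rewrite [X in X *m _]mulmxA H_cube scaleN1r mulNmx -!mulmxA.
  by rewrite !HTK HTH.
- move: (T_GL_expE 4); rewrite -to_PGLX -!projM; move: (T_GL R ^+ 4)%g => T4 T4E.
  by apply: (rel _ _ 1); rewrite scale1r !GL_mulE T4E T1 H_T.
- suff: to_PGL (H_GL * S_GL R * H_GL)%g = to_PGL (S_GL R) by rewrite !projM.
  apply: (rel _ _ 1); rewrite scale1r !GL_mulE S_GL_E -scalemxAr -scalemxAl.
  by rewrite H_M -mulmxA HTH mulmx1.
- move: (T_GL_expE 12); rewrite -to_PGLX.
  move: (T_GL R ^+ 12)%g => T12 T12E.
  suff: to_PGL (S_GL R * T_GL R * S_GL R)%g = to_PGL (T12 * S_GL R * T12)%g.
    by rewrite !projM.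
  (* The left side carries r^2 from its two copies of S and the right side only r; [M_T_M]
     contributes the rest. *)
  apply: (rel _ _ (- r * gauss_sum)).
  rewrite !GL_mulE T12E T1 S_GL_E -!(scalemxAl, scalemxAr) M_T_M !scalerA.
  by congr (_ *: _); rewrite /r; ring.
- move: (T_GL_expE 6) (T_GL_expE 2); rewrite -!to_PGLX.
  move: (T_GL R ^+ 6)%g (T_GL R ^+ 2)%g => T6 T2 T6E T2E.
  suff: to_PGL (S_GL R * T2 * S_GL R)%g = to_PGL (T6 * S_GL R * H_GL * T6)%g.
    by rewrite !projM.
  apply: (rel _ _ (r * gauss_sum)).
  rewrite !GL_mulE T2E T6E S_GL_E -!(scalemxAl, scalemxAr) M_T2_M !scalerA.
  by congr (_ *: _); rewrite /r; ring.
Qed.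

End MatrixRelations.

(** * The two generating pairs as words in s and t *)

Definition word_P := [:: true] ++ word_pow [:: false] 12 ++ [:: true].
Definition word_Q := [:: true] ++ word_pow [:: false] 3.
Definition word_y1 := word_P ++ word_pow word_Q 2 ++ word_pow word_P 10.
Definition word_x1 := word_pow word_Q 6 ++ word_y1.
Definition word_y2 :=
  word_pow word_Q 5 ++ word_pow word_P 2
  ++ (word_pow word_P 2 ++ word_pow word_Q 6 ++ word_pow word_P 8)
  ++ word_pow word_Q 5 ++ word_pow word_P 2.
Definition word_x2 := word_pow word_Q 5 ++ word_y2.

Local Open Scope group_scope.
Local Open Scope classical_set_scope.

Theorem theorem3p5 (R : realType) :
  let S := S_GL R in
  let T := T_GL R in
  let G := subgroup_generated [set to_PGL S; to_PGL T] in
  let P := S * T^-1 * S in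
  let Q := S * T ^+ 3 in
  let y1 := P * Q ^+ 2 * P ^+ 10 in
  let x1 := Q ^+ 6 * (P * Q ^+ 2 * P ^+ 10) in
  let x2 := Q ^+ 5 * (Q ^+ 5 * P ^+ 2) * (P ^+ 2 * Q ^+ 6 * P ^+ 8)
            * (Q ^+ 5 * P ^+ 2) in
  let y2 := (Q ^+ 5 * P ^+ 2) * (P ^+ 2 * Q ^+ 6 * P ^+ 8)
            * (Q ^+ 5 * P ^+ 2) in
  G = subgroup_generated [set to_PGL x1; to_PGL y1] /\
  G = subgroup_generated [set to_PGL x2; to_PGL y2].
Proof.
move=> S T G P Q y1 x1 x2 y2.
have rels := PGL_relations R; have [[_ t13 _] _ _] := rels.
pose s := to_PGL S; pose t := to_PGL T.
(* Words contain no inverses, so the inverse of T in P is spelled as twelve letters [t]. *)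
have tV : t^-1 = t ^+ 12.
  by apply: (mulgI t); rewrite mulgV -expgS t13.
have PE : to_PGL P = word_val s t word_P.
  by rewrite !projM projV tV /= !expgS expg0 !mulg1 !mulgA.
have QE : to_PGL Q = word_val s t word_Q.
  by rewrite projM to_PGLX /= !expgS expg0 !mulg1 !mulgA.
(* The words below were found by breadth-first search in PSL(2, 13). *)
clearbody P Q; pose x := true; pose y := false.
split.
- have -> : to_PGL x1 = word_val s t word_x1.
    by rewrite !(to_PGLX, projM) PE QE -!word_val_pow -!word_val_cat.
  have -> : to_PGL y1 = word_val s t word_y1.
    by rewrite !(to_PGLX, projM) PE QE -!word_val_pow -!word_val_cat -?catA.
  apply: (@subgroup_generated_words _ s t word_x1 word_y1
    [:: x; y; x; y; x; x; y; x; x; y; x; y; x; x; y; x; y; x; y; x]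
    [:: x; x; y; x; x; y; x; y; x; x; y; x; y; x; y]).
    (* It remains to compare the normal form of the substituted word with that of a single
       letter. *)
    transitivity (word_val s t [:: true]); last by rewrite /= mulg1.
    by apply: (eq_word_val rels); vm_compute.
  transitivity (word_val s t [:: false]); last by rewrite /= mulg1.
  by apply: (eq_word_val rels); vm_compute.
- have -> : to_PGL x2 = word_val s t word_x2.
    by rewrite !(to_PGLX, projM) PE QE -!word_val_pow -!word_val_cat -?catA.
  have -> : to_PGL y2 = word_val s t word_y2.
    by rewrite !(to_PGLX, projM) PE QE -!word_val_pow -!word_val_cat -?catA.
  apply: (@subgroup_generated_words _ s t word_x2 word_y2
    [:: x; y; x; x; y; x; x; y; x; y; x; x; y; x; y; x; y; x; x]
    [:: x; x; y; x; y; x; x; y; x; y; x; y; x; x; y; x; y; x; y; x]).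
    transitivity (word_val s t [:: true]); last by rewrite /= mulg1.
    by apply: (eq_word_val rels); vm_compute.
  transitivity (word_val s t [:: false]); last by rewrite /= mulg1.
  by apply: (eq_word_val rels); vm_compute.
Qed.
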